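(* Let $F:\mathbb{R}^d\to\mathbb{R}^d$ be smooth. A locally exact modification of the explicit Euler scheme for $\dot x=F(x)$ is given by $$x_{n+1}=x_n+\bigl(e^{h_nF'(x_n)}-I\bigr)\bigl(F'(x_n)\bigr)^{-1}F(x_n).$$ That is, this scheme is of the form $x_{n+1}-x_n=\delta(\bar x_n,h_n)F(x_n)$ with $\delta(\bar x,h)=\bigl(e^{hF'(\bar x)}-I\bigr)\bigl(F'(\bar x)\bigr)^{-1}$ and $\bar x_n=x_n$, and it is locally exact at $\bar x_n=x_n$ for every $n$.
   Context: Notation: $F'$ is the Jacobi matrix of $F$; $h_n>0$ is the time step; $\varphi_1(z)=(e^z-1)/z$, $\varphi_1(0)=1$. For a matrix $A$ the expression $(e^{hA}-I)A^{-1}$ is understood as $h\varphi_1(hA)$, so it makes sense also for singular $A$. The explicit Euler scheme is $x_{n+1}-x_n=h_nF(x_n)$; a modification of it is obtained by replacing $h_n$ by a matrix $\delta(\bar x_n,h_n)$ with $\lim_{h\to0}\delta(\bar x_n,h)/h=I$. Local exactness. Consider a one-step scheme (explicit or implicit) for $\dot x=F(x)$ whose coefficients may depend on a point $\bar x$ treated as a fixed parameter. The linearization of the scheme around $\bar x$ is obtained by substituting $x_n=\bar x+\nu_n$, $x_{n+1}=\bar x+\nu_{n+1}$ (with $\bar x$ held fixed, in particular in $\delta(\bar x,h_n)$) and keeping only terms of order at most one in $(\nu_n,\nu_{n+1})$. The linearization of the differential equation around $\bar x$ is $\dot\nu=F'(\bar x)\nu+F(\bar x)$, with $\nu=x-\bar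 x$; its exact discretization (the difference equation whose solution satisfies $\nu_n=\nu(t_n)$) is $\nu_{n+1}=e^{h_nF'(\bar x)}\nu_n+h_n\varphi_1(h_nF'(\bar x))F(\bar x)$. The scheme is locally exact at $\bar x$ if its linearization around $\bar x$, solved for $\nu_{n+1}$, is identical with this exact discretization. A scheme is locally exact if there is a sequence $\bar x_n$ with $\bar x_n-x_n=O(h_n)$ such that the scheme is locally exact at $\bar x_n$ for every $n$; the point $\bar x_n$ may be chosen depending on $x_n,x_{n+1}$, the choice being made after the linearization with $\bar x_n$ fixed. *)

(* Defs.v *)
From HB Require Import structures.
From mathcomp Require Export all_boot all_order all_algebra.
From mathcomp Require Export all_classical all_reals all_analysis.
Export Order.TTheory GRing.Theory Num.Theory.
Export numFieldNormedType.Exports.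

#[export] Set Implicit Arguments.
#[export] Unset Strict Implicit.
#[export] Unset Printing Implicit Defensive.

Local Open Scope classical_set_scope.
Local Open Scope ring_scope.

Section MatrixFunctions.
Variables (R : realType) (d : nat).
Implicit Types (A : 'M[R]_d) (h : R).

Definition expmx A : 'M[R]_d :=
  lim (series (fun k => (k`!%:R)^-1 *: A ^+ k) @ \oo).

(* phi_1(z) = (e^z - 1)/z is the entire function \sum_k z^k/(k+1)!, hence
   makes sense at every matrix. *)
Definition phi1mx A : 'M[R]_d :=
  lim (series (fun k => (k.+1`!%:R)^-1 *: A ^+ k) @ \oo).

(* The expression (e^{hA} - I) A^{-1}, with the convention that it stands for
   h phi_1(hA); see expmx_sub1_divE for invertible A. *)
Definition expmx_sub1_div A h : 'M[R]_d := h *: phi1mx (h *: A).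

Lemma mx_norm_mulmx A (B : 'M[R]_d) : `|A *m B| <= d%:R * `|A| * `|B|.
Proof.
have entry (C : 'M[R]_d) i j : `|C i j| <= `|C|.
  rewrite /Num.norm/= mx_normrE.
  by apply: (le_bigmax _ (fun ij : 'I_d * 'I_d => `|C ij.1 ij.2|) (i, j)).
have P : 0 <= d%:R * `|A| * `|B| by rewrite !mulr_ge0.
rewrite {1}/Num.norm/= mx_normrE.
apply/bigmax_leP; split=> // -[i j] _ /=.
rewrite mxE (le_trans (ler_norm_sum _ _ _))//.
have -> : d%:R * `|A| * `|B| = \sum_(k < d) `|A| * `|B|.
  by rewrite sumr_const card_ord -mulrA mulr_natl.
by apply: ler_sum => k _; rewrite normrM ler_pM// entry.
Qed.

Lemma mx_norm_expr A k : `|A ^+ k| <= `|1 : 'M[R]_d| * (d%:R * `|A|) ^+ k.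
Proof.
elim: k => [|k IH]; first by rewrite !expr0 mulr1.
rewrite exprSr (le_trans (mx_norm_mulmx _ _))// exprSr [leRHS]mulrA.
by rewrite mulrAC [leLHS]mulrC ler_wpM2r// mulr_ge0.
Qed.

Lemma mx_normed_cvg (u : ('M[R]_d)^nat) :
  cvgn [normed series u] -> cvgn (series u).
Proof.
move=> /cauchy_cvgP/cauchy_seriesP u_ncvg.
apply/cauchy_cvgP/cauchy_seriesP => e /u_ncvg.
apply: filterS => n /=; rewrite ger0_norm ?sumr_ge0//.
by apply: le_lt_trans; apply: ler_norm_sum.
Qed.

Lemma is_cvg_series_mx A (c : nat -> R) :
  (forall k, 0 <= c k <= (k`!%:R)^-1) ->
  cvgn (series (fun k => c k *: A ^+ k)).
Proof.
move=> c01; apply: mx_normed_cvg.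
set N := `|1 : 'M[R]_d|; set a := d%:R * `|A|.
have a0 : 0 <= a by rewrite mulr_ge0.
apply: (@series_le_cvg _ _ (fun k => N *: exp_coeff a k)).
- by move=> k /=.
- by move=> k; apply: mulr_ge0; [exact: normr_ge0|exact: exp_coeff_ge0].
- move=> k /=; have /andP[c0 c1] := c01 k.
  rewrite normrZ ger0_norm// /exp_coeff /=.
  rewrite [leRHS]/GRing.scale/= mulrA mulrC.
  by rewrite ler_pM// mx_norm_expr.
- by apply: is_cvg_seriesZ; exact: is_cvg_series_exp_coeff.
Qed.

Lemma is_cvg_expmx A : cvgn (series (fun k => (k`!%:R)^-1 *: A ^+ k)).
Proof. by apply: is_cvg_series_mx => k; rewrite invr_ge0 ler0n lexx. Qed.

Lemma is_cvg_phi1mx A : cvgn (series (fun k => (k.+1`!%:R)^-1 *: A ^+ k)).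
Proof.
apply: is_cvg_series_mx => k; rewrite invr_ge0 ler0n/=.
by rewrite lef_pV2 ?posrE ?ltr0n ?fact_gt0// ler_nat factS leq_pmull.
Qed.

Lemma phi1mx_mul A : phi1mx A *m A = expmx A - 1%:M.
Proof.
have mulA_cont : continuous (mulmxr A : 'M[R]_d -> 'M[R]_d).
  apply/(@linear_bounded_continuous _ _ _ (mulmxr A)).
  apply/linear_boundedP; exists (d%:R * `|A|); split; first by rewrite num_real.
  move=> r Ar B; rewrite /= (le_trans (mx_norm_mulmx _ _))// mulrAC.
  by rewrite ler_wpM2r// ltW.
pose u := series (fun k => (k.+1`!%:R)^-1 *: A ^+ k).
have uA : u n *m A @[n --> \oo] --> phi1mx A *m A.
  exact: (cvg_comp _ _ (@is_cvg_phi1mx A) (mulA_cont (phi1mx A))).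
have uE : (fun n => u n *m A) =
    (fun n => series (fun k => (k`!%:R)^-1 *: A ^+ k) n.+1 - 1%:M).
  apply/funext => n; rewrite /u /series/= big_nat_recl// fact0 invr1 scale1r.
  rewrite expr0 addrAC subrr add0r mulmx_suml.
  by apply: eq_bigr => k _; rewrite -scalemxAl exprSr.
rewrite uE in uA; apply: (cvg_unique _ uA) => //.
apply: cvgB; last exact: cvg_cst.
by have := @is_cvg_expmx A; rewrite -cvg_shiftS.
Qed.

Lemma expmx_sub1_divE A h : A \in unitmx ->
  expmx_sub1_div A h = (expmx (h *: A) - 1%:M) *m invmx A.
Proof.
move=> uA; rewrite -phi1mx_mul -scalemxAr -scalemxAl mulmxK//.
Qed.

End MatrixFunctions.

Section LocallyExact.
Variables (R : realType) (d : nat).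
Local Notation vec := 'cV[R]_d.
Local Notation mat := 'M[R]_d.
Implicit Types (F : vec -> vec) (A : mat) (b xb nu : vec) (h t : R).

Fixpoint Ck (k : nat) F : Prop :=
  if k is k'.+1 then
    (forall x, differentiable F x) /\ (forall v, Ck k' (fun x => 'd F x v))
  else continuous F.

Definition smooth F := forall k, Ck k F.

Definition jacobi F (x : vec) : mat :=
  \matrix_(i, j) 'D_(delta_mx j 0) (fun y : vec => F y i 0) x.

(* A one-step scheme is given by its residual: S xb h (x_n, x_{n+1}) = 0 is
   the difference equation with time step h, where xb is the point on which
   the coefficients may depend.  Explicit and implicit schemes are covered. *)
Definition scheme := vec -> R -> vec * vec -> vec.

Definition linearization (S : scheme) xb h (nu nu' : vec) : vec :=
  S xb h (xb, xb) + 'd (S xb h) (xb, xb) (nu, nu').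

(* E is the one-step map of the exact discretization, with time step h, of
   v' = A v + b. *)
Definition exact_discretization A b h (E : vec -> vec) :=
  forall t nu nu', nu' = E nu <->
    exists v : R -> vec,
      [/\ forall s, is_derive s (1 : R) v (A *m v s + b), v t = nu
        & v (t + h) = nu'].

Definition exact_step A b h nu : vec :=
  expmx (h *: A) *m nu + (h *: phi1mx (h *: A)) *m b.

Definition locally_exact_at F (S : scheme) xb h :=
  let E := exact_step (jacobi F xb) (F xb) h in
  [/\ exact_discretization (jacobi F xb) (F xb) h E,
      differentiable (S xb h) (xb, xb)
    & forall nu nu', linearization S xb h nu nu' = 0 <-> nu' = E nu].

(* Local exactness along a numerical trajectory x with time steps h, for the
   choice xb_n of the points. *)
Definition locally_exact F (S : scheme) (h : nat -> R) (x xb : nat -> vec) :=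
  (exists C, forall n, `|xb n - x n| <= C * h n) /\
  (forall n, locally_exact_at F S (xb n) (h n)).

Definition modified_euler F (delta : vec -> R -> mat) : scheme :=
  fun xb h z => z.2 - z.1 - delta xb h *m F z.1.

Definition step_modification (delta : vec -> R -> mat) :=
  forall xb, h^-1 *: delta xb h @[h --> 0^'] --> (1%:M : mat).

End LocallyExact.

(* Main.v *)
Require Import Defs.
Local Open Scope classical_set_scope.
Local Open Scope ring_scope.

(** Write A = F'(x), b = F(x) and Phi(h) = h phi_1(hA) = (e^{hA} - I) A^{-1}.
    Everything rests on three facts about the two entire functions e^{sA} and
    Phi(s):
      (e^{sA})' = A e^{sA},    Phi'(s) = e^{sA},    Phi(s) A = e^{sA} - I.

    The scheme has residual nu' - nu - Phi(h) F(x + nu), in which Phi(h) is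
    held fixed. Its linearization is therefore
      nu' - nu - Phi(h) b - Phi(h) A nu,
    and since Phi(h) A = e^{hA} - I this vanishes exactly when
    nu' = e^{hA} nu + Phi(h) b, which is the exact step
    ([exact_step_jacobiE], [locally_exact_at_modified_euler]).

    That this step really is the time-h flow of v' = A v + b is the variation
    of constants formula. Existence: s |-> e^{(s-t)A} nu + Phi(s-t) b is a
    solution ([exact_step_solution]). Uniqueness: for a solution v the quantity
    e^{(s-u)A} v(u) + Phi(s-u) b does not depend on u, so its values at u = s
    and u = t agree ([exact_step_unique]).

    Finally Phi(h)/h --> I as h --> 0 says that Phi(0) = 0 and
    Phi'(0) = e^0 = I.

    The derivatives come from differentiating scalar power series term by
    term, one matrix entry at a time ([is_derive_expmx],
    [is_derive_expmx_sub1_div]). *)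

(** * Differentiation of matrix-valued functions *)

Section MatrixCalculus.
Context {R : realType}.

Lemma cvg_coord {T : Type} {F : set_system T} {FF : Filter F} {m n : nat}
    (u : T -> 'M[R]_(m, n)) (l : 'M[R]_(m, n)) i j :
  u x @[x --> F] --> l -> u x i j @[x --> F] --> l i j.
Proof.
move=> ul; apply: (cvg_comp u (fun M : 'M[R]_(m, n) => M i j) ul).
exact: coord_continuous.
Qed.

(** Finitely many entries converge uniformly, so derivatives can be taken entry
    by entry. The rules of this section then follow from those for real-valued
    functions. *)
Lemma is_derive_mxP {V : normedModType R} {m n : nat} (M : V -> 'M[R]_(m, n))
    t v (dM : 'M[R]_(m, n)) :
  is_derive t v M dM <->
  forall i j, is_derive t v (fun x => M x i j) (dM i j).
Proof.
split=> [[Mt <-] i j|Mt].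
  apply: DeriveDef; first by move/derivable_mxP : Mt; apply.
  by rewrite derive_mx// mxE.
have dMt : derivable M t v by apply/derivable_mxP => i j; case: (Mt i j).
apply: DeriveDef => //; rewrite derive_mx//.
by apply/matrixP => i j; rewrite mxE; case: (Mt i j).
Qed.

Lemma is_derive_mulmx {m n p : nat} (M : R -> 'M[R]_(m, n))
    (N : R -> 'M[R]_(n, p)) s dM dN :
  is_derive s (1 : R) M dM -> is_derive s (1 : R) N dN ->
  is_derive s (1 : R) (fun s => M s *m N s) (dM *m N s + M s *m dN).
Proof.
move=> /is_derive_mxP Ms /is_derive_mxP Ns; apply/is_derive_mxP => i j.
have := is_derive_sum (fun k => is_deriveM (Ms i k) (Ns k j)).
congr is_derive; last first.
  rewrite !mxE -big_split/=; apply: eq_bigr => k _.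
  by rewrite addrC; congr (_ + _); rewrite /GRing.scale/= mulrC.
by apply/funext => x; rewrite mxE fct_sumE.
Qed.

Lemma is_derive_mulmxl {m n p : nat} (M : 'M[R]_(m, n))
    (N : R -> 'M[R]_(n, p)) s dN :
  is_derive s (1 : R) N dN -> is_derive s (1 : R) (fun s => M *m N s) (M *m dN).
Proof.
move=> Ns; have := is_derive_mulmx (is_derive_cst M s (1 : R)) Ns.
by rewrite mul0mx add0r.
Qed.

Lemma is_derive_mulmxr {m n p : nat} (M : R -> 'M[R]_(m, n))
    (N : 'M[R]_(n, p)) s dM :
  is_derive s (1 : R) M dM -> is_derive s (1 : R) (fun s => M s *m N) (dM *m N).
Proof.
move=> Ms; have := is_derive_mulmx Ms (is_derive_cst N s (1 : R)).
by rewrite mulmx0 addr0.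
Qed.

Lemma is_derive_mx_comp {m n : nat} (M : R -> 'M[R]_(m, n)) (g : R -> R)
    s dM dg :
  is_derive (g s) (1 : R) M dM -> is_derive s (1 : R) g dg ->
  is_derive s (1 : R) (fun s => M (g s)) (dg *: dM).
Proof.
move=> /is_derive_mxP Mg gs; apply/is_derive_mxP => i j.
by have := is_derive1_comp (Mg i j) gs; rewrite mxE mulrC.
Qed.

Lemma is_derive_0_is_cst_mx {m n : nat} (M : R -> 'M[R]_(m, n)) s t :
  (forall s, is_derive s (1 : R) M 0) -> M s = M t.
Proof.
move=> M0; apply/matrixP => i j.
apply: (@is_derive_0_is_cst _ (fun s => M s i j)) => u.
by have /is_derive_mxP/(_ i j) := M0 u; rewrite mxE.
Qed.

End MatrixCalculus.

(** * Derivatives of the matrix exponential and of (e^{sA} - I) A^{-1} *)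

Section MatrixExponential.
Variables (R : realType) (d : nat).
Implicit Types (A B : 'M[R]_d).

Lemma expr_scalemx A (s : R) k : (s *: A) ^+ k = s ^+ k *: A ^+ k.
Proof.
elim: k => [|k IH]; first by rewrite !expr0 scale1r.
by rewrite !exprS IH -[LHS]scalemxAl -[X in s *: X]scalemxAr scalerA.
Qed.

(** The left factor [B] is what makes this family of scalar power series stable
    under term-by-term differentiation: by [pseries_diffs_expmx] the
    differentiated series is the one for [B *m A]. *)
Lemma cvg_pseries_expmx A B (s : R) i j :
  pseries (fun k => (B *m A ^+ k) i j / k`!%:R) s @ \oo -->
  (B *m expmx (s *: A)) i j.
Proof.
rewrite [X in _ --> X]mxE.
have -> : pseries (fun k => (B *m A ^+ k) i j / k`!%:R) s =
    (fun n => \sum_(l < d)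
      B i l * (series (fun k => k`!%:R^-1 *: (s *: A) ^+ k) n) l j).
  apply/funext => n; rewrite /pseries /series/=.
  under [RHS]eq_bigr do rewrite summxE mulr_sumr.
  rewrite exchange_big; apply: eq_bigr => k _ /=.
  rewrite mxE !mulr_suml; apply: eq_bigr => l _.
  rewrite mxE expr_scalemx mxE -!mulrA; congr (_ * _).
  by rewrite mulrCA; congr (_ * _); rewrite mulrC.
apply: cvg_big => [|l _]; first exact: add_continuous.
apply: cvgM; first exact: cvg_cst.
apply: cvg_coord; exact: is_cvg_expmx.
Qed.

Lemma is_cvg_pseries_expmx A B (s : R) i j :
  cvgn (pseries (fun k => (B *m A ^+ k) i j / k`!%:R) s).
Proof. by apply/cvg_ex; eexists; exact: cvg_pseries_expmx. Qed.

Lemma pseries_diffs_expmx A B i j :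
  pseries_diffs (fun k => (B *m A ^+ k) i j / k`!%:R : R) =
  fun k => (B *m A *m A ^+ k) i j / k`!%:R.
Proof.
apply/funext => k; rewrite /pseries_diffs factS natrM invfM mulrCA.
by rewrite mulVKf// exprS mulmxA.
Qed.

Lemma is_derive_expmx A (s : R) :
  is_derive s (1 : R) (fun s => expmx (s *: A)) (A *m expmx (s *: A)).
Proof.
apply/is_derive_mxP => i j.
(* The series converge everywhere; any point of modulus larger than |s| can
   serve as the one at which convergence is required. *)
have sK : `|s| < `| `|s| + 1| by rewrite [ltRHS]ger0_norm ?addr_ge0// ltrDl.
have cE t : limn (pseries (fun k => (1%:M *m A ^+ k) i j / k`!%:R) t) =
    expmx (t *: A) i j.
  by rewrite -[expmx _]mul1mx; exact/cvg_lim/cvg_pseries_expmx.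
have := @pseries_snd_diffs R (fun k => (1%:M *m A ^+ k) i j / k`!%:R)
  (`|s| + 1) s.
rewrite !pseries_diffs_expmx => /(_ (@is_cvg_pseries_expmx _ _ _ _ _)
  (@is_cvg_pseries_expmx _ _ _ _ _) (@is_cvg_pseries_expmx _ _ _ _ _) sK).
rewrite (cvg_lim _ (@cvg_pseries_expmx A _ s i j))// mul1mx.
by congr is_derive; apply/funext => t; rewrite cE.
Qed.

Lemma is_derive_expmx_sub1_div A (s : R) :
  is_derive s (1 : R) (expmx_sub1_div A) (expmx (s *: A)).
Proof.
apply/is_derive_mxP => i j.
(* The coefficients of s phi_1(sA) = \sum_k s^(k+1) A^k / (k+1)!, whose
   term-by-term derivative is the series of e^{sA}. *)
pose c k : R := if k is k'.+1 then (A ^+ k') i j / k`!%:R else 0.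
have cE t : pseries c t @ \oo --> expmx_sub1_div A t i j.
  rewrite -cvg_shiftS/= /expmx_sub1_div mxE.
  have -> : (fun n => pseries c t n.+1) = (fun n =>
      t * (series (fun k => k.+1`!%:R^-1 *: (t *: A) ^+ k) n) i j).
    apply/funext => n; rewrite /pseries /series/= big_nat_recl//= mul0r add0r.
    rewrite summxE mulr_sumr; apply: eq_bigr => k _.
    rewrite mxE expr_scalemx mxE exprS mulrCA; congr (_ * _).
    by rewrite -mulrA mulrC -mulrA.
  apply: cvgM; first exact: cvg_cst.
  apply: cvg_coord; exact: is_cvg_phi1mx.
have dc : pseries_diffs c = fun k => (1%:M *m A ^+ k) i j / k`!%:R.
  apply/funext => k; rewrite /pseries_diffs /c factS natrM invfM mulrCA.
  by rewrite mulVKf// mul1mx.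
have sK : `|s| < `| `|s| + 1| by rewrite [ltRHS]ger0_norm ?addr_ge0// ltrDl.
have := @pseries_snd_diffs R c (`|s| + 1) s.
rewrite dc pseries_diffs_expmx => /(_ _ (@is_cvg_pseries_expmx _ _ _ _ _)
  (@is_cvg_pseries_expmx _ _ _ _ _) sK).
rewrite (cvg_lim _ (@cvg_pseries_expmx A 1%:M s i j))// mul1mx.
have -> : (fun x => limn (pseries c x)) = (fun x => expmx_sub1_div A x i j).
  by apply/funext => t; exact/cvg_lim/cE.
by apply; apply/cvg_ex; eexists; exact: cE.
Qed.

Lemma expmx0 : expmx (0 : 'M[R]_d) = 1%:M.
Proof. by have := phi1mx_mul (0 : 'M[R]_d); rewrite mulmx0 => /esym/subr0_eq. Qed.

Lemma expmx_sub1_div0 A : expmx_sub1_div A 0 = 0.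
Proof. by rewrite /expmx_sub1_div scale0r. Qed.

Lemma expmx_sub1_divK A h : expmx_sub1_div A h *m A = expmx (h *: A) - 1%:M.
Proof. by rewrite -phi1mx_mul -scalemxAl -scalemxAr. Qed.

(** Unlike in [expmx_sub1_divK], [A] stands on the left. Both sides vanish at 0
    and, as functions of h, have the same derivative A e^{hA}. *)
Lemma mul_expmx_sub1_div A h : A *m expmx_sub1_div A h = expmx (h *: A) - 1%:M.
Proof.
pose D s := A *m expmx_sub1_div A s - expmx (s *: A).
have D' s : is_derive s (1 : R) D 0.
  have := is_deriveB (is_derive_mulmxl A (is_derive_expmx_sub1_div A s))
    (is_derive_expmx A s).
  by rewrite subrr.
have := is_derive_0_is_cst_mx h 0 D'.
rewrite /D expmx_sub1_div0 mulmx0 scale0r expmx0 sub0r => /eqP.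
by rewrite subr_eq addrC => /eqP.
Qed.

(** With Phi = (e^{hA} - I) A^{-1}, both sides, after subtracting [A], are equal
    to A Phi A. *)
Lemma expmx_comm A h : expmx (h *: A) *m A = A *m expmx (h *: A).
Proof.
have : (expmx (h *: A) - 1%:M) *m A = A *m (expmx (h *: A) - 1%:M).
  by rewrite -{1}mul_expmx_sub1_div -expmx_sub1_divK mulmxA.
by rewrite mulmxBl mulmxBr mul1mx mulmx1 => /addIr.
Qed.

End MatrixExponential.

(** * Variation of constants for v' = A v + b *)

Section LinearEquation.
Variables (R : realType) (d : nat).
Implicit Types (A : 'M[R]_d) (b nu : 'cV[R]_d).

Lemma exact_step_solution A b nu (t : R) :
  let v s := exact_step A b (s - t) nu in
  v t = nu /\ forall s, is_derive s (1 : R) v (A *m v s + b).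
Proof.
split=> [|s]; rewrite /exact_step.
  by rewrite subrr scale0r expmx0 mul1mx scale0r mul0mx addr0.
have st : is_derive s (1 : R) (fun s => s - t) (1 : R).
  by have := is_derive_shift s (1 : R) (- t).
have E' := is_derive_mx_comp (g := +%R^~ (- t)) (is_derive_expmx A (s - t)) st.
have P' := is_derive_mx_comp (g := +%R^~ (- t))
    (is_derive_expmx_sub1_div A (s - t)) st.
have := is_deriveD (is_derive_mulmxr nu E') (is_derive_mulmxr b P').
congr is_derive; rewrite !scale1r mulmxDr !mulmxA -addrA; congr (_ + _).
by rewrite -/(expmx_sub1_div A (s - t)) mul_expmx_sub1_div mulmxBl mul1mx subrK.
Qed.

(** Transport each v(u) to time s along the flow: since v solves the equation,
    the result is the same for all u, hence for u = s and u = t. *)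
Lemma exact_step_unique A b (v : R -> 'cV[R]_d) t s :
  (forall u, is_derive u (1 : R) v (A *m v u + b)) ->
  v s = exact_step A b (s - t) (v t).
Proof.
move=> v'.
pose D u := expmx ((s - u) *: A) *m v u + expmx_sub1_div A (s - u) *m b.
have D' u : is_derive u (1 : R) D 0.
  have su : is_derive u (1 : R) (fun u => s - u) (- 1 : R).
    have := is_deriveB (is_derive_cst s u 1) (is_derive_id u (1 : R)).
    by rewrite sub0r.
  have E' := is_derive_mx_comp (g := +%R s \o -%R) (is_derive_expmx A (s - u)) su.
  have P' := is_derive_mx_comp (g := +%R s \o -%R)
    (is_derive_expmx_sub1_div A (s - u)) su.
  have := is_deriveD (is_derive_mulmx E' (v' u)) (is_derive_mulmxr b P').
  congr is_derive; rewrite !scaleN1r mulmxDr !mulmxA expmx_comm !mulNmx.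
  by rewrite addrA addNr add0r subrr.
have := is_derive_0_is_cst_mx s t D'.
rewrite {1}/D subrr scale0r expmx0 mul1mx expmx_sub1_div0 mul0mx addr0.
exact.
Qed.

Lemma exact_discretization_exact_step A b (h : R) :
  exact_discretization A b h (exact_step A b h).
Proof.
move=> t nu nu'; split=> [->|[v [v' <- <-]]].
  have [vt v'] := exact_step_solution A b nu t.
  exists (fun s => exact_step A b (s - t) nu).
  split; [exact: v'|exact: vt|].
  by rewrite addrAC subrr add0r.
by rewrite (exact_step_unique t (t + h) v') addrAC subrr add0r.
Qed.

End LinearEquation.

(** * Linearization of the modified Euler scheme *)

Section ModifiedEuler.
Variables (R : realType) (d : nat).
Implicit Types (F : 'cV[R]_d -> 'cV[R]_d).

(** The product is a linear combination of the columns of [D] whose coefficients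
    are the coordinates of the vector, and coordinates are continuous. *)
Lemma continuous_mulmx (D : 'M[R]_d) :
  continuous (mulmx D : 'cV[R]_d -> 'cV[R]_d).
Proof.
have -> : (mulmx D : 'cV[R]_d -> 'cV[R]_d) =
    (fun v => \sum_(j < d) v j 0 *: col j D).
  apply/funext => v; apply/matrixP => i k.
  rewrite mxE summxE; apply: eq_bigr => j _.
  by rewrite !mxE mulrC (ord1 k).
apply: continuous_big => [|j _ v]; first exact: add_continuous.
apply: differentiable_continuous; apply: differentiableZl.
exact: differentiable_coord.
Qed.

(** The Jacobi matrix collects partial derivatives of coordinates, so both sides
    agree on the canonical basis, hence everywhere by linearity. *)
Lemma diff_jacobi F x v : differentiable F x -> 'd F x v = jacobi F x *m v.
Proof.
move=> Fx; rewrite {1}(matrix_sum_delta v) linear_sum/=.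
apply/matrixP => i k; rewrite (ord1 k) summxE mxE; apply: eq_bigr => j _.
rewrite big_ord1 linearZ/= mxE mulrC; congr (_ * _).
by rewrite -deriveE// derive_mx ?mxE//; exact: diff_derivable.
Qed.

Lemma is_diff_modified_euler F (delta : 'cV[R]_d -> R -> 'M[R]_d) xb h p :
  differentiable F p.1 ->
  is_diff p (modified_euler F delta xb h)
    (fun w => w.2 - w.1 - delta xb h *m (jacobi F p.1 *m w.1)).
Proof.
move=> Fp.
have dfst : is_diff p fst fst.
  apply: DiffDef; first by apply: linear_differentiable => q; exact: cvg_fst.
  by rewrite diff_lin// => q; exact: cvg_fst.
have dsnd : is_diff p snd snd.
  apply: DiffDef; first by apply: linear_differentiable => q; exact: cvg_snd.
  by rewrite diff_lin// => q; exact: cvg_snd.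
have dF : is_diff (fst p) F (mulmx (jacobi F p.1)).
  by apply: DiffDef => //; apply/funext => v; rewrite diff_jacobi.
have dM : is_diff (F p.1) (mulmx (delta xb h)) (mulmx (delta xb h)).
  apply: DiffDef.
    exact/linear_differentiable/continuous_mulmx.
  by rewrite diff_lin//; exact: continuous_mulmx.
exact: (is_diffB (is_diffB dsnd dfst) (is_diff_comp (is_diff_comp dfst dF) dM)).
Qed.

(** The factor e^{hA} of the exact step is I + Phi(h) A. In this form the step
    is the zero of the linearized residual of the scheme, because Phi(h) is
    also the matrix that multiplies F there. *)
Lemma exact_step_jacobiE F (x nu : 'cV[R]_d) h :
  exact_step (jacobi F x) (F x) h nu =
  nu + expmx_sub1_div (jacobi F x) h *m (jacobi F x *m nu)
     + expmx_sub1_div (jacobi F x) h *m F x.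
Proof.
by rewrite /exact_step mulmxA expmx_sub1_divK mulmxBl mul1mx subrKC.
Qed.

Lemma locally_exact_at_modified_euler F x h : differentiable F x ->
  locally_exact_at F
    (modified_euler F (fun xb h => expmx_sub1_div (jacobi F xb) h)) x h.
Proof.
move=> Fx; have [dS valS] := is_diff_modified_euler
  (fun xb h => expmx_sub1_div (jacobi F xb) h) x h (p := (x, x)) Fx.
split=> [||nu nu']; [exact: exact_discretization_exact_step|exact: dS|].
rewrite /linearization valS.
rewrite exact_step_jacobiE /modified_euler/= subrr sub0r.
set a := _ *m F x; set c := _ *m (_ *m nu).
rewrite (_ : - a + (nu' - nu - c) = nu' - (nu + c + a)).
  by split=> [/subr0_eq//|->]; rewrite subrr.
by rewrite addrC !opprD !addrA.
Qed.

(** The quotient delta(h)/h is the difference quotient at 0 of delta, which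
    vanishes there and has derivative e^0 = I. *)
Lemma step_modification_expmx_sub1_div F :
  step_modification (fun xb h => expmx_sub1_div (jacobi F xb) h).
Proof.
move=> xb; set A := jacobi F xb.
have [dD valD] := is_derive_expmx_sub1_div A 0.
have : h^-1 *: (expmx_sub1_div A (h *: (1 : R) + 0) - expmx_sub1_div A 0)
    @[h --> 0^'] --> 'D_(1 : R) (expmx_sub1_div A) 0 by exact: dD.
rewrite valD scale0r expmx0 expmx_sub1_div0.
by under eq_fun do rewrite subr0 addr0 [_%:A]mulr1.
Qed.

End ModifiedEuler.

Theorem proposition3p2 (R : realType) (d : nat) (F : 'cV[R]_d -> 'cV[R]_d)
    (smoothF : smooth F) :
  let delta := fun (xb : 'cV[R]_d) (h : R) => expmx_sub1_div (jacobi F xb) h in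
  let S := modified_euler F delta in
  step_modification delta /\
  forall (h : nat -> R) (x : nat -> 'cV[R]_d), (forall n, 0 < h n) ->
    (forall n, x n.+1 = x n + expmx_sub1_div (jacobi F (x n)) (h n) *m F (x n)
       <-> S (x n) (h n) (x n, x n.+1) = 0) /\
    locally_exact F S h x x.
Proof.
move=> delta S; split; first exact: step_modification_expmx_sub1_div.
move=> h x _; split=> [n|].
  rewrite /S /modified_euler/= -addrA -opprD.
  by split=> [->|/subr0_eq//]; rewrite subrr.
split=> [|n]; first by exists 0 => n; rewrite subrr normr0 mul0r.
apply: locally_exact_at_modified_euler.
by have [+ _] := smoothF 1; apply.
Qed.
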